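(* Let $T$ be a complete theory with monster model $\mathcal{U}$ and $M\prec\mathcal{U}$ small. Suppose $\mu\in\mathfrak{M}_x(\mathcal{U})$ is definable over $M$, and $\nu\in\mathfrak{M}_y(\mathcal{U})$ is Borel definable and finitely satisfiable in $M$. If $\mu|_M$ has a definable global extension $\hat\mu\in\mathfrak{M}_x(\mathcal{U})$ such that $(\hat\mu\otimes\nu)|_M=(\nu\otimes\hat\mu)|_M$, then $(\mu\otimes\nu)|_M=(\nu\otimes\mu)|_M$.
   Context: $\mathfrak{M}_x(\mathcal{U})$ are global Keisler measures; $\mu|_M$ is the restriction to $\mathcal{L}_M$-formulas. $\mu$ is invariant over small $A$ if $\mu(\phi(x,b))=\mu(\phi(x,b'))$ whenever $b\equiv_A b'$; then $F^\phi_{\mu,A}(q)=\mu(\phi(x,b))$ for $b\models q\in S_y(A)$. $\mu$ is definable (resp. Borel definable) over $A$ if $A$-invariant and every $F^\phi_{\mu,A}$ ($\phi$ an $\mathcal{L}$-formula) is continuous (resp. Borel); without ''over $A$'', over some small set. $\nu$ is finitely satisfiable in $M$ if every $\mathcal{L}_{\mathcal{U}}$-formula of positive $\nu$-measure is realized in $M$. Morley product for $\mu$ Borel definable over $A$: $(\mu\otimes\nu)(\phi(x,y))=\int_{S_y(B)}F^\phi_{\mu,B}\,d(\nu|_B)$ for small $B\supseteq A$ with $\phi$ over $B$. *)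

(* Defs.v *)
From HB Require Import structures.
From mathcomp Require Import all_boot all_order all_algebra.
From mathcomp Require Import all_classical all_reals all_analysis.

Set Implicit Arguments.
Unset Strict Implicit.
Unset Printing Implicit Defensive.

Import Order.TTheory GRing.Theory Num.Theory.
Import numFieldNormedType.Exports.

Local Open Scope classical_set_scope.
Local Open Scope ring_scope.

Record language := Language {
  fsym : Type;
  far : fsym -> nat;
  rsym : Type;
  rar : rsym -> nat }.

(* [term L X] and [formula L X] have their free atoms in X.  An atom is a free
   variable or a constant naming a parameter: an L_C-formula with free
   variables indexed by V is an inhabitant of [formula L (V + C)], and an
   L-formula is an inhabitant of [formula L V].  [All] binds the atom [None]. *)
Inductive term (L : language) (X : Type) : Type :=
  | Atom of X
  | App (f : fsym L) of ('I_(far f) -> term L X).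

Inductive formula (L : language) (X : Type) : Type :=
  | Fls
  | Eqn of term L X & term L X
  | Rel (r : rsym L) of ('I_(rar r) -> term L X)
  | Imp of formula L X & formula L X
  | All of formula L (option X).
Arguments Fls {L X}.

Definition Neg L (X : Type) (p : formula L X) : formula L X := Imp p Fls.
Definition Or L (X : Type) (p q : formula L X) : formula L X := Imp (Neg p) q.

Fixpoint tmap L (X Y : Type) (h : X -> Y) (t : term L X) : term L Y :=
  match t with
  | Atom x => Atom L (h x)
  | App f ts => App (fun i => tmap h (ts i))
  end.

Fixpoint fmap L (X Y : Type) (h : X -> Y) (p : formula L X) : formula L Y :=
  match p with
  | Fls => Fls
  | Eqn t u => Eqn (tmap h t) (tmap h u)
  | Rel r ts => Rel (fun i => tmap h (ts i))
  | Imp p q => Imp (fmap h p) (fmap h q)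
  | All p => All (fmap (omap h) p)
  end.

(* The point only records that the carrier is nonempty. *)
Record structure (L : language) := Structure {
  carrier :> Type;
  carrier_pt : carrier;
  func : forall f : fsym L, ('I_(far f) -> carrier) -> carrier;
  pred_of : forall r : rsym L, ('I_(rar r) -> carrier) -> Prop }.
Arguments func {L s}.
Arguments pred_of {L s}.

Fixpoint teval L (N : structure L) (X : Type) (e : X -> N) (t : term L X) : N :=
  match t with
  | Atom x => e x
  | App f ts => func f (fun i => teval e (ts i))
  end.

Definition scons (N X : Type) (e : X -> N) (a : N) (o : option X) : N :=
  if o is Some x then e x else a.

Fixpoint sat L (N : structure L) (X : Type) (p : formula L X) (e : X -> N) :
    Prop :=
  match p with
  | Fls => False
  | Eqn t u => teval e t = teval e u
  | Rel r ts => pred_of r (fun i => teval e (ts i))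
  | Imp p q => sat p e -> sat q e
  | All p => forall a : N, sat p (scons e a)
  end.

Definition sentence (L : language) := formula L void.

Definition holds L (N : structure L) (s : sentence L) : Prop :=
  sat s (of_void N).

Definition models L (N : structure L) (T : set (sentence L)) : Prop :=
  forall s, T s -> holds N s.

Definition entails L (T : set (sentence L)) (s : sentence L) : Prop :=
  forall N : structure L, models N T -> holds N s.

Definition complete_theory L (T : set (sentence L)) : Prop :=
  (exists N : structure L, models N T) /\
  forall s, entails T s \/ entails T (Neg s).

Section Substructures.
Variables (L : language) (U : structure L).

Definition func_closed (M : set U) : Prop :=
  forall (f : fsym L) (a : 'I_(far f) -> U),
    (forall i, M (a i)) -> M (func f a).

Definition substructure (M : set U) (m : set_type M) (cM : func_closed M) :
    structure L :=
  @Structure L (set_type M) m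
    (fun f a => SigSub (mem_set (cM f (fun i => \val (a i))
                          (fun i => set_valP (a i)))))
    (fun r a => pred_of r (fun i => \val (a i))).

(* M is the universe of an elementary substructure of U *)
Definition elementary_sub (M : set U) : Prop :=
  exists (m : set_type M) (cM : func_closed M),
  forall (V : finType) (p : formula L V) (e : V -> set_type M),
    sat p (e : V -> substructure m cM) <-> sat p (fun v => \val (e v) : U).

Definition automorphism (s : U -> U) : Prop :=
  [/\ bijective s,
      (forall (f : fsym L) (a : 'I_(far f) -> U),
         s (func f a) = func f (fun i => s (a i))) &
      (forall (r : rsym L) (a : 'I_(rar r) -> U),
         pred_of r (fun i => s (a i)) <-> pred_of r a)].

End Substructures.

Section Types.
Variables (L : language) (U : structure L).

(* the valuation with variables sent to [a] and constants to themselves *)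
Definition asg (X : Type) (A : set U) (a : X -> U) (z : X + set_type A) : U :=
  match z with inl x => a x | inr c => \val c end.

Definition gasg (X : Type) (a : X -> U) (z : X + U) : U :=
  match z with inl x => a x | inr c => c end.

Definition complete_type (X : Type) (A : set U)
    (p : set (formula L (X + set_type A))) : Prop :=
  (forall s : set (formula L (X + set_type A)), finite_set s -> s `<=` p ->
     exists a : X -> U, forall phi, s phi -> sat phi (asg a)) /\
  (forall phi, p phi \/ p (Neg phi)).

Definition stype (X : Type) (A : set U) := {p | @complete_type X A p}.

Definition realizes (X : Type) (A : set U) (a : X -> U)
    (p : stype X A) : Prop :=
  forall phi, sval p phi -> sat phi (asg a).

Lemma tp_complete (X : Type) (A : set U) (a : X -> U) :
  @complete_type X A [set phi | sat phi (asg a)].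
Proof.
split=> [s _ sp|phi]; first by exists a => phi /sp.
by have [h|h] := pselect (sat phi (asg a)); [left | right].
Qed.

Definition tp (X : Type) (A : set U) (a : X -> U) : stype X A :=
  exist _ _ (tp_complete A a).

Definition clopen_of (X : Type) (A : set U) (phi : formula L (X + set_type A)) :
    set (stype X A) := [set p | sval p phi].

HB.instance Definition _ X A := gen_eqMixin (stype X A).
HB.instance Definition _ X A := gen_choiceMixin (stype X A).
HB.instance Definition _ X A :=
  isPointed.Build (stype X A) (tp A (fun=> carrier_pt U)).
HB.instance Definition _ X A :=
  isSubBaseTopological.Build (stype X A) (range (@clopen_of X A)) id.

End Types.

Definition borel (T : ptopologicalType) := g_sigma_algebraType (@open T).

(* small means of cardinality less than that of K *)
Definition small (K V : Type) (A : set V) : Prop := ~ ([set: K] #<= A)%card.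

Definition saturated L (K : Type) (U : structure L) : Prop :=
  forall (X : finType) (A : set U), small K A ->
  forall p : stype X A, exists a : X -> U, realizes a p.

Definition strongly_homogeneous L (K : Type) (U : structure L) : Prop :=
  forall (A : set U) (f : U -> U), small K A ->
    (forall (V : finType) (p : formula L V) (e : V -> U),
       (forall v, A (e v)) -> (sat p e <-> sat p (fun v => f (e v)))) ->
    exists2 s : U -> U, automorphism s & forall a, A a -> s a = f a.

(* K stands for the cardinal |K|, which exceeds |L| + aleph_0 *)
Definition monster L (T : set (sentence L)) (K : Type) (U : structure L) :=
  [/\ models U T, small K [set: fsym L + rsym L + nat],
      saturated K U & strongly_homogeneous K U].

(* a finitely additive probability measure on L_U-formulas modulo U *)
Record kmeasure (R : realType) L (U : structure L) (X : Type) := KMeasure {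
  km :> formula L (X + U) -> R;
  km_ge0 : forall phi, 0 <= km phi;
  km_valid : forall phi,
    (forall a : X -> U, sat phi (gasg a)) -> km phi = 1;
  km_additive : forall phi psi,
    (forall a : X -> U, ~ (sat phi (gasg a) /\ sat psi (gasg a))) ->
    km (Or phi psi) = km phi + km psi }.

Section Measures.
Variables (R : realType) (L : language) (U : structure L).

(* an L_A-formula seen as an L_U-formula *)
Definition up (X : Type) (A : set U) (phi : formula L (X + set_type A)) :
    formula L (X + U) :=
  fmap (fun z => match z with inl x => inl x | inr c => inr (\val c) end) phi.

Definition restr (X : Type) (A : set U) (m : formula L (X + U) -> R)
    (phi : formula L (X + set_type A)) : R := m (up phi).

Definition finitely_satisfiable (X : Type) (M : set U) (nu : kmeasure R U X) :
    Prop :=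
  forall phi, 0 < nu phi ->
    exists2 a : X -> U, (forall i, M (a i)) & sat phi (gasg a).

(* phi(x, b) *)
Definition inst (X Y : Type) (A : set U)
    (phi : formula L ((X + Y) + set_type A))
    (b : Y -> U) : formula L (X + U) :=
  fmap (fun z =>
         match z with
         | inl (inl x) => inl x
         | inl (inr y) => inr (b y)
         | inr c => inr (\val c)
         end) phi.

(* an L-formula seen as an L_A-formula *)
Definition pure (X : Type) (A : set U) (phi : formula L X) :
  formula L (X + set_type A) := fmap inl phi.

Definition equiv_over (Y : Type) (A : set U) (b b' : Y -> U) : Prop :=
  tp A b = tp A b'.

Definition invariant_over (X : Type) (mu : kmeasure R U X) (A : set U) : Prop :=
  forall (Y : finType) (phi : formula L (X + Y)) (b b' : Y -> U),
    equiv_over A b b' -> mu (inst (pure A phi) b) = mu (inst (pure A phi) b').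

(* F^phi_{mu,A}, for phi(x, y) an L_A-formula; single-valued when mu is
   A-invariant, and everywhere defined when A is small *)
Definition Fib (X Y : Type) (mu : kmeasure R U X) (A : set U)
    (phi : formula L ((X + Y) + set_type A)) (q : stype Y A) : R :=
  xget 0 [set r | exists2 b : Y -> U, realizes b q & r = mu (inst phi b)].

Variable K : Type.

Definition definable_over (X : Type) (mu : kmeasure R U X) (A : set U) : Prop :=
  [/\ small K A, invariant_over mu A &
      forall (Y : finType) (phi : formula L (X + Y)),
        continuous (Fib mu (pure A phi))].

Definition borel_definable_over (X : Type) (mu : kmeasure R U X) (A : set U) :
    Prop :=
  [/\ small K A, invariant_over mu A &
      forall (Y : finType) (phi : formula L (X + Y)),
        measurable_fun setT (Fib mu (pure A phi) : borel (stype Y A) -> R)].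

Definition definable (X : Type) (mu : kmeasure R U X) : Prop :=
  exists A, definable_over mu A.

Definition borel_definable (X : Type) (mu : kmeasure R U X) : Prop :=
  exists A, borel_definable_over mu A.

Definition regular (T : ptopologicalType) (P : probability (borel T) R) :=
  forall E : set (borel T), measurable E ->
    P E = ereal_inf [set P O | O in [set O : set T | open O /\ E `<=` O]] /\
    P E = ereal_sup [set P C | C in [set C : set T | compact C /\ C `<=` E]].

(* P is the regular Borel probability measure on S_y(B) identified with nu|_B;
   it exists and is unique *)
Definition represents (Y : Type) (nu : kmeasure R U Y) (B : set U)
    (P : probability (borel (stype Y B)) R) : Prop :=
  regular P /\ forall phi, P (clopen_of phi) = (nu (up phi))%:E.

(* The value on theta(x, y) is the integral computed over any small B such that
   mu is Borel definable over some A included in B and theta is over B. *)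
Definition morley (X Y : Type) (mu : kmeasure R U X) (nu : kmeasure R U Y)
    (theta : formula L ((X + Y) + U)) : R :=
  xget 0 [set r | exists (A B : set U)
      (phi : formula L ((X + Y) + set_type B))
      (P : probability (borel (stype Y B)) R),
    [/\ borel_definable_over mu A, small K B /\ A `<=` B, up phi = theta,
        represents nu P & r = \int[P]_q Fib mu phi q]].

Definition swap_vars (X Y : Type) (phi : formula L ((X + Y) + U)) :
    formula L ((Y + X) + U) :=
  fmap (fun z =>
         match z with
         | inl (inl x) => inl (inr x)
         | inl (inr y) => inl (inl y)
         | inr c => inr c
         end) phi.

(* the product of nu and mu on formulas whose variables are listed as (x, y) *)
Definition morley_swap (X Y : Type) (nu : kmeasure R U Y) (mu : kmeasure R U X)
  (theta : formula L ((X + Y) + U)) : R := morley nu mu (swap_vars theta).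

End Measures.
Arguments restr {R L U X} A m phi.

(* Main.v *)
(* Fix an L_M-formula phi(x,y).  The value of (mu (x) nu)(phi) does not depend on
   the choice of mu among the definable measures with a given restriction to M:
   if B contains M and the parameters over which mu and muh are definable, the
   two fibre functions on S_y(B) are continuous and agree at the types realized
   in M, and the open set where they differ is nu-null because nu is finitely
   satisfiable in M.

   Likewise for (nu (x) mu)(phi).  Finite satisfiability makes nu M-invariant, so
   the fibre function of nu on S_x(B) factors through the restriction map to
   S_x(M).  It need not be known to be Borel on S_x(M): if the preimage E' in
   S_x(B) of a set E of M-types is Borel, a compact subset of E' and an open
   superset of E' can be compared through a single L_M-formula, so that by
   regularity the measure of E' is determined by the restriction to M.

   Hence both products can be computed with muh in place of mu.  The same
   comparison of preimages shows that the Morley product is independent of the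
   parameter set over which it is computed. *)
From HB Require Import structures.
Require Import Defs.
From mathcomp Require Import all_boot all_order all_algebra.
From mathcomp Require Import all_classical all_reals all_analysis.
From mathcomp Require Import finmap lra measurable_realfun.

Set Implicit Arguments.
Unset Strict Implicit.
Unset Printing Implicit Defensive.

Import Order.TTheory GRing.Theory Num.Theory.
Import numFieldNormedType.Exports.
(* [fmap] would otherwise denote the image of a filter. *)
Import Defs.

Local Open Scope classical_set_scope.
Local Open Scope ring_scope.

(** * Substitution in formulas *)

Section Substitution.
Variable L : language.

Lemma tmap_comp (X Y Z : Type) (g : Y -> Z) (h : X -> Y) (t : term L X) :
  tmap g (tmap h t) = tmap (g \o h) t.
Proof. by elim: t => //= f ts IH; congr App; apply/funext => i; exact: IH. Qed.

Lemma fmap_comp (X Y Z : Type) (g : Y -> Z) (h : X -> Y) (p : formula L X) :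
  fmap g (fmap h p) = fmap (g \o h) p.
Proof.
elim: p Y Z g h => {X} //=.
- by move=> X t u Y Z g h; rewrite !tmap_comp.
- by move=> X r ts Y Z g h; congr Rel; apply/funext => i; rewrite tmap_comp.
- by move=> X p IHp q IHq Y Z g h; rewrite IHp IHq.
- move=> X p IH Y Z g h; rewrite IH; congr (All (fmap _ p)).
  by apply/funext => -[].
Qed.

Lemma teval_tmap (N : structure L) (X Y : Type) (h : X -> Y) (t : term L X)
    (e : Y -> N) :
  teval e (tmap h t) = teval (e \o h) t.
Proof. by elim: t => //= f ts IH; congr func; apply/funext => i; exact: IH. Qed.

Lemma sat_fmap (N : structure L) (X Y : Type) (h : X -> Y) (p : formula L X)
    (e : Y -> N) :
  sat (fmap h p) e <-> sat p (e \o h).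
Proof.
elim: p Y h e => {X} //=.
- by move=> X t u Y h e; rewrite !teval_tmap.
- move=> X r ts Y h e.
  suff -> : (fun i => teval e (tmap h (ts i))) = (fun i => teval (e \o h) (ts i)).
    by [].
  by apply/funext => i; rewrite teval_tmap.
- by move=> X p IHp q IHq Y h e; split=> H /IHp /H /IHq.
- move=> X p IH Y h e.
  have E a : scons e a \o omap h = scons (e \o h) a by apply/funext => -[].
  by split=> H a; [rewrite -E; apply/IH; exact: H | apply/IH; rewrite E; exact: H].
Qed.

Definition on_constants (V C D : Type) (c : C -> D) (z : V + C) : V + D :=
  match z with inl v => inl v | inr z => inr (c z) end.

(** Only finitely many constants occur in a term. Those of the arguments of a function symbol are
    indexed together by a dependent sum over the argument positions. *)
Lemma tmap_finite_constants (W V C : Type) (t : term L W) (h : W -> V + C) :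
  exists (Z : finType) (u : term L (V + Z)) (c : Z -> C),
    tmap h t = tmap (on_constants c) u.
Proof.
elim: t => [w|f ts IH] /=.
  case hw: (h w) => [v|c].
    by exists void, (Atom L (inl v)), (of_void C).
  by exists unit, (Atom L (inr tt)), (fun=> c).
have [Z {}IH] := fin_all_exists IH; have [u {}IH] := fin_all_exists IH.
have [c HZ] := fin_all_exists IH.
exists {i : 'I_(far f) & Z i},
  (App (fun i => tmap (on_constants (fun z => Tagged Z z)) (u i))),
  (fun z => c (tag z) (tagged z)) => /=.
by congr App; apply/funext => i; rewrite HZ tmap_comp; congr tmap; apply/funext=> -[].
Qed.

Lemma on_constants_comp (V C D E : Type) (d : D -> E) (c : C -> D) :
  on_constants d \o on_constants c = on_constants (d \o c) :> (V + C -> V + E).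
Proof. by apply/funext => -[]. Qed.

(* Under a binder the fresh variable has to be counted among the variables, not
   the constants; this reassociates the two kinds of atoms. *)
Definition bind_var (V C : Type) (z : option V + C) : option (V + C) :=
  match z with inl o => omap inl o | inr c => Some (inr c) end.

Definition unbind_var (V C W : Type) (h : W -> V + C) (o : option W) :
    option V + C :=
  match o with
  | None => inl None
  | Some w => match h w with inl v => inl (Some v) | inr c => inr c end
  end.

(** The induction runs over an arbitrary renaming [h], because under a quantifier the atoms become
    [option W] and the induction hypothesis is applied to [unbind_var h]. *)
Lemma fmap_finite_constants (W V C : Type) (p : formula L W) (h : W -> V + C) :
  exists (Z : finType) (q : formula L (V + Z)) (c : Z -> C),
    fmap h p = fmap (on_constants c) q.
Proof.
elim: p V h => {W} [W|W t u|W r ts|W p IHp q IHq|W p IH] V h /=.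
- by exists void, Fls, (of_void C).
- have [Z [t' [c ->]]] := tmap_finite_constants t h.
  have [Z' [u' [c' ->]]] := tmap_finite_constants u h.
  exists (Z + Z')%type, (Eqn (tmap (on_constants inl) t') (tmap (on_constants inr) u')),
    (fun z => match z with inl z => c z | inr z => c' z end).
  by rewrite /= !tmap_comp !on_constants_comp.
- have [Z HZ] := fin_all_exists (fun i => tmap_finite_constants (ts i) h).
  have [u {}HZ] := fin_all_exists HZ; have [c {}HZ] := fin_all_exists HZ.
  exists {i : 'I_(rar r) & Z i},
    (Rel (fun i => tmap (on_constants (fun z => Tagged Z z)) (u i))),
    (fun z => c (tag z) (tagged z)) => /=.
  by congr Rel; apply/funext => i; rewrite HZ tmap_comp on_constants_comp.
- have [Z [p' [c ->]]] := IHp _ h.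
  have [Z' [q' [c' ->]]] := IHq _ h.
  exists (Z + Z')%type, (Imp (fmap (on_constants inl) p') (fmap (on_constants inr) q')),
    (fun z => match z with inl z => c z | inr z => c' z end).
  by rewrite /= !fmap_comp !on_constants_comp.
- have [Z [q [c Hq]]] := IH _ (unbind_var h).
  exists Z, (All (fmap (@bind_var _ _) q)), c => /=; congr All.
  have -> : omap h = @bind_var V C \o unbind_var h.
    by apply/funext => -[w|] //=; case: (h w).
  rewrite -fmap_comp Hq !fmap_comp; congr fmap.
  by apply/funext => -[[]|].
Qed.

End Substitution.

(** * Type spaces *)

Section TypeSpaces.
Variables (L : language) (U : structure L).

Lemma sat_up (X : Type) (A : set U) (phi : formula L (X + set_type A)) a :
  sat (up phi) (gasg a) <-> sat phi (asg a).
Proof.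
rewrite sat_fmap; set h := (X in gasg a \o X).
by have -> : gasg a \o h = asg a by apply/funext => -[].
Qed.

Section OneSpace.
Variables (X : Type) (A : set U).
Implicit Types (p q : stype X A) (phi psi : formula L (X + set_type A)).

Lemma sat_Neg (N : structure L) (V : Type) (f : formula L V) (e : V -> N) :
  sat (Neg f) e <-> ~ sat f e.
Proof. by []. Qed.

Lemma sat_Or (N : structure L) (V : Type) (f g : formula L V) (e : V -> N) :
  sat (Or f g) e <-> sat f e \/ sat g e.
Proof.
rewrite /= ; split=> [H|[fe|ge] // /(_ fe)//].
by have [?|?] := pselect (sat f e); [left|right; exact: H].
Qed.

(** Otherwise [Neg psi] lies in [p], and together with [s] it forms a finite part of [p] without a
    common solution. *)
Lemma stype_closed p (s : set (formula L (X + set_type A))) psi :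
  finite_set s -> s `<=` sval p ->
  (forall a, (forall phi, s phi -> sat phi (asg a)) -> sat psi (asg a)) ->
  sval p psi.
Proof.
move=> fs sp H; case: (proj2 (svalP p) psi) => // pn.
have [||a Ha] := proj1 (svalP p) (s `|` [set Neg psi]).
- by rewrite finite_setU; split.
- by move=> phi [/sp|->].
- by case: (Ha (Neg psi)) => /=; [right | apply: H => phi sphi; apply: Ha; left].
Qed.

Lemma stype_Neg p phi : sval p (Neg phi) <-> ~ sval p phi.
Proof.
split=> [pn pp|np]; last by case: (proj2 (svalP p) phi).
have [||a Ha] := proj1 (svalP p) [set phi; Neg phi] => //.
- by move=> _ [->|->].
- by apply: (Ha (Neg phi)); [right | apply: Ha; left].
Qed.

Lemma stype_sub p phi psi :
  (forall a, sat phi (asg a) -> sat psi (asg a)) -> sval p phi -> sval p psi.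
Proof.
by move=> H pp; apply: (stype_closed (s := [set phi])) => [//|_ ->//|a Ha]; exact/H/Ha.
Qed.

Lemma stype_Or p phi psi : sval p (Or phi psi) <-> sval p phi \/ sval p psi.
Proof.
split=> [H|[]]; last 2 first.
- by apply: stype_sub => a ?; apply/sat_Or; left.
- by apply: stype_sub => a ?; apply/sat_Or; right.
have [?|/stype_Neg np] := pselect (sval p phi); first by left.
right; apply: (stype_closed (s := [set Or phi psi; Neg phi])) => //.
- by move=> _ [->|->].
- move=> a Ha; have /sat_Or[|//] := Ha (Or phi psi) (or_introl erefl).
  by move=> sa; case: (Ha (Neg phi) (or_intror erefl) sa).
Qed.

Lemma stype_Fls p : ~ sval p Fls.
Proof.
move=> pF; have [||a Ha] := proj1 (svalP p) [set Fls] => //.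
- by move=> _ ->.
- exact: (Ha Fls).
Qed.

Lemma clopen_of_sub phi psi : clopen_of phi `<=` clopen_of psi <->
  forall a, sat phi (asg a) -> sat psi (asg a).
Proof.
split=> [H a sa|H p]; last exact: stype_sub.
exact: (H (tp A a) sa).
Qed.

Lemma stype_inj p q : sval p `<=` sval q -> p = q.
Proof.
move=> pq; suff E : sval p = sval q.
  by case: p q E {pq} => [p cp] [q cq] /= E; exact: eq_exist.
apply/seteqP; split=> // phi qphi; have [//|] := pselect (sval p phi).
by move=> /stype_Neg/pq/stype_Neg.
Qed.

Lemma realizes_tp (a : X -> U) q : realizes a q -> q = tp A a.
Proof. by move=> H; apply: stype_inj => phi /H. Qed.

Lemma tp_realizes (a : X -> U) : realizes a (tp A a).
Proof. by move=> phi. Qed.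

Lemma open_clopen_of phi : open (clopen_of phi).
Proof.
exists [set clopen_of phi]; last by rewrite bigcup_set1.
move=> _ ->; exists [fset (clopen_of phi)]%fset => /=.
  by move=> V; rewrite !inE => /eqP ->; apply/mem_set; exists phi.
by apply/seteqP; split=> [p /(_ (clopen_of phi))|p pp V] /=;
  [apply; rewrite inE | rewrite inE => /eqP ->].
Qed.

Definition disjunction (I : Type) (f : I -> formula L (X + set_type A))
    (s : seq I) := foldr (fun i => Or (f i)) Fls s.

Lemma stype_disjunction (I : eqType) (f : I -> formula L (X + set_type A)) s p :
  sval p (disjunction f s) <-> exists2 i, i \in s & sval p (f i).
Proof.
elim: s => [|i s IH]; first by split=> [/stype_Fls|[]].
rewrite [disjunction _ _]/= stype_Or IH; split=> [[pi|[j js pj]]|[j]].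
- by exists i; rewrite ?inE ?eqxx.
- by exists j; rewrite ?inE ?js ?orbT.
- by rewrite inE => /predU1P[->|js] pj; [left|right; exists j].
Qed.

Lemma open_stype_nbhs (O : set (stype X A)) p : open O -> O p ->
  exists2 phi, sval p phi & clopen_of phi `<=` O.
Proof.
move=> [D' sD <-] [V D'V Vp].
have [F FD VE] := sD _ D'V.
have /choice[f Hf] (W : set (stype X A)) :
    exists phi, W \in F -> W = clopen_of phi.
  have [WF|//] := pselect (W \in F); last by exists Fls.
  by have /set_mem[phi _ <-] := FD _ WF; exists phi.
have VP q : V q <-> forall W, W \in F -> sval q (f W).
  rewrite -VE; split=> [Vq W WF|Hq W /= WF].
  - by have := Vq W WF; rewrite {1}(Hf W WF).
  - by rewrite /= (Hf W WF); exact: Hq.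
(* This is the conjunction of the formulas [f W] for [W] in [F], written through De Morgan; it turns
   a basic neighbourhood into a single clopen set. *)
exists (Neg (disjunction (fun W => Neg (f W)) F)).
  apply/stype_Neg => /stype_disjunction[W WF /stype_Neg]; apply.
  by move/VP : Vp => /(_ W WF).
move=> q /stype_Neg qn; exists V => //; apply/VP => W WF; apply: contrapT => nq.
by apply: qn; apply/stype_disjunction; exists W => //; exact/stype_Neg.
Qed.

Lemma closed_clopen_of phi : closed (clopen_of phi).
Proof.
rewrite -openC; suff -> : ~` clopen_of phi = clopen_of (Neg phi).
  exact: open_clopen_of.
by apply/seteqP; split=> p /=; rewrite /clopen_of /= stype_Neg.
Qed.

Lemma stype_hausdorff : hausdorff_space (stype X A).
Proof.
move=> p q clpq; apply: stype_inj => phi pp; apply: contrapT => /stype_Neg qn.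
have [||r []] := clpq (clopen_of phi) (clopen_of (Neg phi)).
- by apply: open_nbhs_nbhs; split=> //; exact: open_clopen_of.
- by apply: open_nbhs_nbhs; split=> //; exact: open_clopen_of.
- by move=> rp /stype_Neg.
Qed.

(** An ultrafilter converges to the type of all formulas whose clopen set belongs to it. Finitely
    many such clopen sets have a common point, and that type, being finitely satisfiable, yields a
    common solution. *)
Lemma stype_compact : compact [set: stype X A].
Proof.
rewrite compact_ultra => F FU _.
have FF : ProperFilter F := ultra_proper.
pose p := [set phi | F (clopen_of phi)].
have pfin (s : set (formula L (X + set_type A))) : finite_set s -> s `<=` p ->
    F (\bigcap_(phi in s) clopen_of phi).
  move=> /(@finite_fsetP {classic formula L (X + set_type A)} s)[D sE] sp.
  rewrite sE; apply: (@filter_bigI _ {classic formula L (X + set_type A)}) => phi phiD.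
  by apply: sp; rewrite sE.
have cp : @complete_type L U X A p.
  split=> [s fs /pfin-/(_ fs) /filter_ex[q sq]|phi].
    by have [a Ha] := proj1 (svalP q) s fs sq; exists a.
  have [?|Fn] := in_ultra_setVsetC (clopen_of phi) FU; [by left|right].
  by apply: filterS Fn => q /stype_Neg.
exists (exist _ p cp); split=> // O; rewrite nbhsE => -[V [oV Vp] VO].
have [phi pphi phiV] := open_stype_nbhs oV Vp.
by apply: filterS pphi => q /phiV/VO.
Qed.

(** Finitely many clopen neighbourhoods inside [O] cover [C], and their union is defined by one
    disjunction. *)
Lemma compact_open_clopen (C O : set (stype X A)) :
  compact C -> open O -> C `<=` O ->
  exists2 phi, C `<=` clopen_of phi & clopen_of phi `<=` O.
Proof.
move=> cC oO CO.
have /choice[f Hf] (p : stype X A) :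
    exists phi, C p -> sval p phi /\ clopen_of phi `<=` O.
  have [Cp|//] := pselect (C p); last by exists Fls.
  by have [phi ? ?] := open_stype_nbhs oO (CO _ Cp); exists phi.
move: cC; rewrite compact_cover => /(_ _ C (fun p => clopen_of (f p)))[||D DC CD].
- by move=> p _; exact: open_clopen_of.
- by move=> p Cp; exists p => //; case: (Hf p Cp).
exists (disjunction f D).
  by move=> p /CD[q qD pq]; apply/stype_disjunction; exists q.
by move=> p /stype_disjunction[q /DC/set_mem/Hf[_]]; apply.
Qed.

End OneSpace.

Section Pull.
Variables (X X' : Type) (A B : set U) (h : X' + set_type A -> X + set_type B).
Hypothesis hA : forall c (a : X -> U), asg a (h (inr c)) = \val c.

Definition pull_asg (a : X -> U) (x : X') : U := asg a (h (inl x)).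

Lemma asg_pull (a : X -> U) : asg a \o h = asg (pull_asg a).
Proof. by apply/funext => -[x|c] //=; rewrite hA. Qed.

Lemma sat_pull (a : X -> U) psi :
  sat (fmap h psi) (asg a) <-> sat psi (asg (pull_asg a)).
Proof. by rewrite sat_fmap asg_pull. Qed.

Lemma pull_complete (q : stype X B) :
  @complete_type L U X' A [set psi | sval q (fmap h psi)].
Proof.
split=> [s fs sq|phi]; last exact: (proj2 (svalP q) (fmap h phi)).
have [||a Ha] := proj1 (svalP q) (fmap h @` s).
- exact: finite_image.
- by move=> _ [phi sphi <-]; exact: sq.
- by exists (pull_asg a) => phi sphi; apply/sat_pull/Ha; exists phi.
Qed.

(** The renaming [h] may turn variables into constants of [B], while [hA] preserves the values of
    the constants of [A]. This covers both restriction to fewer parameters and the extension of a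
    tuple by fixed parameters. *)
Definition pull (q : stype X B) : stype X' A := exist _ _ (pull_complete q).

Lemma pull_realizes a q : realizes a q -> realizes (pull_asg a) (pull q).
Proof. by move=> aq phi /aq/sat_pull. Qed.

Lemma pull_continuous : continuous pull.
Proof.
apply/continuousP => O oO; rewrite openE => p Op.
have [phi pphi phiO] := open_stype_nbhs oO Op.
apply: (@filterS _ _ _ (clopen_of (fmap h phi))).
  by move=> q qphi; apply: phiO.
by apply: open_nbhs_nbhs; split=> //; exact: open_clopen_of.
Qed.

End Pull.

End TypeSpaces.

(** * Regular Borel measures on type spaces *)

Section KeislerMeasures.
Variables (R : realType) (L : language) (U : structure L) (X : Type).
Variable m : kmeasure R U X.
Implicit Types phi psi : formula L (X + U).

Lemma km_Neg phi psi :
  (forall a, sat phi (gasg a) <-> ~ sat psi (gasg a)) -> m phi + m psi = 1.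
Proof.
move=> H; rewrite -km_additive; last by move=> a [/H].
by apply: km_valid => a /=; rewrite H => /contrapT.
Qed.

Lemma km_ext phi psi :
  (forall a, sat phi (gasg a) <-> sat psi (gasg a)) -> m phi = m psi.
Proof.
move=> H; apply: (addrI (m (Neg phi))); rewrite !km_Neg // => a /=.
by rewrite H.
Qed.

Lemma km_sub phi psi :
  (forall a, sat phi (gasg a) -> sat psi (gasg a)) -> m phi <= m psi.
Proof.
move=> H; have -> : m psi = m (Or phi (Neg (Or phi (Neg psi)))).
  apply: km_ext => a; have := H a; rewrite sat_Or sat_Neg sat_Or sat_Neg.
  by have [?|?] := pselect (sat phi (gasg a)); have [?|?] := pselect (sat psi (gasg a));
    tauto.
by rewrite km_additive ?lerDl ?km_ge0// => a; rewrite sat_Neg sat_Or; tauto.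
Qed.

Lemma km_le1 phi : m phi <= 1.
Proof.
rewrite -(@km_Neg phi (Neg phi)) ?lerDl ?km_ge0// => a; rewrite sat_Neg.
by have [?|?] := pselect (sat phi (gasg a)); tauto.
Qed.

Lemma km_Or_le phi psi : m (Or phi psi) <= m phi + m psi.
Proof.
have -> : m (Or phi psi) = m (Or phi (Neg (Imp psi phi))).
  apply: km_ext => a; rewrite !sat_Or sat_Neg /=.
  by have [?|?] := pselect (sat phi (gasg a)); have [?|?] := pselect (sat psi (gasg a));
    tauto.
rewrite km_additive; last by move=> a; rewrite sat_Neg /=; tauto.
rewrite lerD2l; apply: km_sub => a; rewrite sat_Neg /=.
by have [?|?] := pselect (sat psi (gasg a)); tauto.
Qed.

Lemma km_Fls : m Fls = 0.
Proof.
have : m (Neg Fls) + m Fls = 1 by apply: km_Neg => a /=.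
by rewrite km_valid => [/eqP|a //]; rewrite -subr_eq0 addrAC subrr add0r => /eqP.
Qed.

End KeislerMeasures.

Section RepresentingMeasure.
Variables (R : realType) (L : language) (U : structure L) (X : Type) (A : set U).
Variable m : kmeasure R U X.
Local Notation S := (stype X A).
Implicit Types (O : set S) (E : set S) (phi psi : formula L (X + set_type A)).

Lemma km_up_sub phi psi : clopen_of phi `<=` clopen_of psi -> m (up phi) <= m (up psi).
Proof.
by move=> /clopen_of_sub H; apply: km_sub => a /sat_up/H/sat_up.
Qed.

Lemma km_up_disjoint phi psi : clopen_of phi `&` clopen_of psi `<=` set0 ->
  m (up (Or phi psi)) = m (up phi) + m (up psi).
Proof.
move=> dis; apply: km_additive => a [/sat_up sphi /sat_up spsi].
exact: (dis (tp A a)).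
Qed.

Lemma km_up_disjunction (I : Type) (f : I -> formula L (X + set_type A)) (s : seq I) :
  m (up (disjunction f s)) <= \sum_(i <- s) m (up (f i)).
Proof.
elim: s => [|i s IH]; first by rewrite big_nil [m _]km_Fls.
by rewrite big_cons; apply: le_trans (km_Or_le _ _ _) _; rewrite lerD2l.
Qed.

(** Inner regularity forces this value on an open set, since a compact subset of it lies in a clopen
    one. Outer regularity then dictates [outer_content], and the measure is obtained by the
    Carathéodory construction. *)
Definition inner_content (O : set S) : \bar R :=
  ereal_sup [set (m (up phi))%:E | phi in [set phi | clopen_of phi `<=` O]].

Definition outer_content (E : set S) : \bar R :=
  ereal_inf [set inner_content O | O in [set O | open O /\ E `<=` O]].

Local Notation inner := inner_content.
Local Notation outer := outer_content.

Local Open Scope ereal_scope.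

Let inner_ge O phi : clopen_of phi `<=` O -> (m (up phi))%:E <= inner O.
Proof. by move=> sO; apply: ereal_sup_ubound; exists phi. Qed.

Let inner_ge0 O : 0 <= inner O.
Proof.
apply: le_trans (inner_ge (phi := Fls) _); first by rewrite lee_fin km_ge0.
by move=> p /stype_Fls.
Qed.

Let inner_le1 O : inner O <= 1.
Proof. by apply: ge_ereal_sup => _ [phi _ <-]; rewrite lee_fin km_le1. Qed.

Let inner_sub O O' : O `<=` O' -> inner O <= inner O'.
Proof.
move=> OO'; apply: ge_ereal_sup => _ [phi pO <-]; apply: inner_ge.
exact: subset_trans OO'.
Qed.

Let outer_le E O : open O -> E `<=` O -> outer E <= inner O.
Proof. by move=> oO EO; apply: ereal_inf_lbound; exists O. Qed.

Let outer_open O : open O -> outer O = inner O.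
Proof.
move=> oO; apply/eqP; rewrite eq_le outer_le//=.
by apply: le_ereal_inf_tmp => _ [G [_ OG] <-]; exact: inner_sub.
Qed.

Let outer_ge0 E : 0 <= outer E.
Proof. by apply: le_ereal_inf_tmp => _ [G _ <-]. Qed.

Let outer_fin E : outer E \is a fin_num.
Proof.
rewrite ge0_fin_numE// (le_lt_trans (outer_le openT _))//.
by rewrite (le_lt_trans (inner_le1 _)) ?ltry.
Qed.

Let outer0 : outer set0 = 0.
Proof.
rewrite outer_open; last exact: open0.
apply/eqP; rewrite eq_le inner_ge0 andbT.
apply: ge_ereal_sup => _ [phi p0 <-]; rewrite lee_fin -(km_Fls m).
by apply: (@km_up_sub phi Fls) => p /p0.
Qed.

(** A clopen subset of the union is compact, so finitely many clopen sets, each inside a single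
    [G n], cover it; this reduces countable subadditivity to finite subadditivity. *)
Let inner_bigcup (G : nat -> set S) : (forall n, open (G n)) ->
  inner (\bigcup_n G n) <= \sum_(n <oo) inner (G n).
Proof.
move=> oG; apply: ge_ereal_sup => _ [phi /= pG <-].
have /choice[f Hf] (p : S) : exists x : nat * formula L (X + set_type A),
    sval p phi -> sval p x.2 /\ clopen_of x.2 `<=` G x.1.
  have [pp|//] := pselect (sval p phi); last by exists (0%N, Fls).
  have [n _ Gp] := pG _ pp.
  by have [psi ? ?] := open_stype_nbhs (oG n) Gp; exists (n, psi).
have : compact (clopen_of phi).
  exact: (subclosed_compact (@closed_clopen_of _ _ _ _ phi) (@stype_compact L U X A)).
rewrite compact_cover.
move=> /(_ _ (clopen_of phi) (fun p => clopen_of (f p).2))[||D Dphi phiD].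
- by move=> p _; exact: open_clopen_of.
- by move=> p pp; exists p => //; case: (Hf p pp).
(* The formulas of the finite cover are grouped by the index of the open set that contains them. *)
pose g n := disjunction (fun p => (f p).2) [seq p <- D | (f p).1 == n].
have gG n : clopen_of (g n) `<=` G n.
  move=> p /stype_disjunction[q]; rewrite mem_filter.
  by move=> /andP[/eqP <- /Dphi/set_mem/Hf[_]]; exact.
pose N := (\max_(p <- D) (f p).1).+1.
have phig : clopen_of phi `<=` clopen_of (disjunction g (index_iota 0 N)).
  move=> p /phiD[q /= qD pq].
  apply/(stype_disjunction (I:=nat) g (index_iota 0 N)); exists (f q).1.
    by rewrite mem_index_iota /= ltnS; exact: leq_bigmax_seq.
  by apply/stype_disjunction; exists q; rewrite // mem_filter eqxx.
apply: le_trans (nneseries_lim_ge N _) => [|n _ _]; last exact: inner_ge0.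
apply: (@le_trans _ _ (\sum_(0 <= n < N) m (up (g n)))%:E).
  rewrite lee_fin; apply: le_trans (km_up_sub phig) _.
  exact: km_up_disjunction.
by rewrite -sumEFin; apply: lee_sum => n _; exact: inner_ge.
Qed.

Let outer_sub : {homo outer : E E' / E `<=` E' >-> E <= E'}.
Proof.
move=> E E' EE'; apply: le_ereal_inf_tmp => _ [G [oG EG] <-].
by apply: outer_le => //; exact: subset_trans EG.
Qed.

Let outer_sigma_subadditive : sigma_subadditive outer.
Proof.
move=> F; apply/lee_addgt0Pr => e e0.
have /choice[G HG] (n : nat) : exists G, [/\ open G, F n `<=` G &
    inner G <= outer (F n) + (e / (2 ^ n.+1)%:R)%:E].
  have en : (0 < e / (2 ^ n.+1)%:R)%R by rewrite divr_gt0// ltr0n expn_gt0.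
  have [_ [G [oG FG] <-] /ltW ?] := lb_ereal_inf_adherent en (outer_fin (F n)).
  by exists G.
have oG n : open (G n) by case: (HG n).
apply: le_trans (epsilon_trick _ _ (ltW e0)); last by move=> n; exact: outer_ge0.
apply: (@le_trans _ _ (\sum_(n <oo) inner (G n))).
  apply: le_trans (inner_bigcup oG); apply: outer_le.
    by apply: bigcup_open.
  by apply: subset_bigcup => n _; case: (HG n).
by apply: lee_nneseries => n _ => [_|]; [exact: inner_ge0 | case: (HG n)].
Qed.

HB.instance Definition _ := isOuterMeasure.Build R S outer
  outer0 outer_ge0 outer_sub outer_sigma_subadditive.

(** For open [G] containing [E], choose a clopen set inside [G] and [O], then a second one inside
    [G] and disjoint from the first. Their measures add up to that of a clopen subset of [G], and
    the remainder of [G] after the first contains the part of [E] outside [O]. *)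
Let open_caratheodory O : open O -> outer.-caratheodory O.
Proof.
move=> oO; apply: le_caratheodory_measurable => E.
apply: le_ereal_inf_tmp => _ [G [oG EG] <-].
have oGO : open (G `&` O) by exact: openI.
rewrite -leeBrDr ?outer_fin//.
apply: (@le_trans _ _ (inner (G `&` O))).
  by apply: outer_le => //; exact: setSI.
apply: ge_ereal_sup => _ [phi /= pGO <-].
rewrite leeBrDr ?outer_fin//.
apply: (@le_trans _ _ ((m (up phi))%:E + inner (G `&` ~` clopen_of phi))).
  apply: leeD2l; apply: outer_le.
    by apply: openI => //; apply: closed_openC; exact: closed_clopen_of.
  by move=> p [Ep Op]; split; [exact: EG|move=> /pGO[]].
rewrite -leeBrDl//; apply: ge_ereal_sup => _ [psi /= pG <-].
rewrite EFinN leeBrDl// -EFinD -km_up_disjoint; last by move=> p [pphi /pG[]].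
by apply: inner_ge => p /stype_Or[/pGO[]|/pG[]].
Qed.

Definition representing_measure : set (borel S) -> \bar R := outer.

Let measurable_caratheodory (E : set (borel S)) :
  measurable E -> outer.-caratheodory (E : set S).
Proof.
apply: smallest_sub; last exact: open_caratheodory.
exact: (@sigma_algebra_measurable _ (caratheodory_type outer)).
Qed.

Let representing_measure_sigma_additive : semi_sigma_additive representing_measure.
Proof.
move=> F mF tF mUF; apply: (@caratheodory_measure_sigma_additive R S outer) => //.
- by move=> n; exact: measurable_caratheodory.
- exact: measurable_caratheodory.
Qed.

HB.instance Definition _ := isMeasure.Build _ (borel S) R representing_measure
  outer0 outer_ge0 representing_measure_sigma_additive.

Let representing_measure_setT : representing_measure setT = 1.
Proof.
apply/eqP; rewrite eq_le; apply/andP; split.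
  exact: le_trans (outer_le openT _) (inner_le1 _).
rewrite /representing_measure outer_open; last exact: openT.
apply: le_trans (inner_ge (phi := Neg Fls) _) => //.
by rewrite lee_fin km_valid// => a /=.
Qed.

HB.instance Definition _ :=
  Measure_isProbability.Build _ (borel S) R representing_measure
  representing_measure_setT.

Lemma representing_measureP :
  represents m (representing_measure : probability (borel S) R).
Proof.
split=> [E mE|phi]; last first.
  rewrite /representing_measure [LHS]outer_open; last exact: open_clopen_of.
  apply/eqP; rewrite eq_le inner_ge// andbT.
  by apply: ge_ereal_sup => _ [psi /= ? <-]; rewrite lee_fin; exact: km_up_sub.
have PE : outer E = ereal_inf [set outer V | V in [set V | open V /\ E `<=` V]].
  congr ereal_inf; apply/seteqP.
  by split=> _ [V [oV EV] <-]; exists V => //; rewrite outer_open.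
split; first exact: PE.
apply/eqP; rewrite eq_le; apply/andP; split; last first.
  by apply: ge_ereal_sup => _ [C [_ CE] <-]; exact: outer_sub.
apply/lee_addgt0Pr => e e0.
(* Inner regularity of [E] follows from outer regularity of its complement: the complement of [V] is
   a closed, hence compact, subset of [E]. *)
have [_ [V [oV EV] <-]] := lb_ereal_inf_adherent e0 (outer_fin (~` E)).
rewrite -outer_open// => /ltW H.
have mV : measurable (V : set (borel S)) by exact: sub_sigma_algebra.
have PC W : measurable (W : set (borel S)) -> outer (~` W) = 1 - outer W.
  exact: (@probability_setC _ _ _ (representing_measure : probability (borel S) R)).
apply: (@le_trans _ _ (outer (~` V) + e%:E)); last first.
  apply: leeD2r; apply: ereal_sup_ubound; exists (~` V) => //; split.
    apply: (subclosed_compact (open_closedC oV) (@stype_compact L U X A)).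
    by [].
  by move=> p nVp; apply: contrapT => /EV.
have {H} : outer V <= outer (~` E) + e%:E by [].
change (outer V <= outer (~` E) + e%:E -> outer E <= outer (~` V) + e%:E).
rewrite !PC//; move: (outer E) (outer V) (outer_fin E) (outer_fin V).
by move=> [a| |] [b| |] // _ _; rewrite -!EFinB -!EFinD !lee_fin; lra.
Qed.

End RepresentingMeasure.

(** * Unions of small sets *)

Section Cardinals.

(** The relation need not be functional: choice extracts a function, which the second condition
    makes injective. Injections can thus be described on [A] alone, without default values. *)
Lemma card_le_relP (T U : Type) (A : set T) (B : set U) :
  (A #<= B)%card <-> exists r : T -> U -> Prop,
    (forall a, A a -> exists2 b, B b & r a b) /\
    (forall a a' b, A a -> A a' -> r a b -> r a' b -> a = a').
Proof.
split=> [/card_leP[f]|[r [rA rI]]].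
  exists (fun a b => exists x : set_type A, \val x = a /\ \val (f x) = b); split.
    move=> a Aa; exists (\val (f (SigSub (mem_set Aa)))); first exact: set_valP.
    by exists (SigSub (mem_set Aa)).
  move=> _ _ b _ _ [x [<- fx]] [y [<- fy]].
  have fxy : f x = f y by apply: val_inj; rewrite fx fy.
  by congr (\val _); apply: ('inj_f _ _ fxy); exact: mem_set.
have [A0|/set0P[a0 Aa0]] := eqVneq A set0; first by rewrite A0 card_ge0.
have [b0 _ _] := rA _ Aa0.
have /choice[f Hf] (a : T) : exists b, A a -> B b /\ r a b.
  have [/rA[b ? ?]|//] := pselect (A a); last by exists b0.
  by exists b.
have fI : {in A &, injective f}.
  move=> a a' /set_mem Aa /set_mem Aa' faa'; apply: (rI a a' (f a)) => //.
    by case: (Hf a Aa).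
  by rewrite faa'; case: (Hf a' Aa').
rewrite -(card_le_eql (inj_card_eq fI)); apply: subset_card_le => _ [a Aa <-].
by case: (Hf a Aa).
Qed.

(** Zorn's lemma gives a maximal partial bijection [G]. If some [a] were outside its domain and some
    [b] outside its range, the pair [(a, b)] could be added. *)
Lemma card_le_total (T U : Type) (A : set T) (B : set U) :
  (A #<= B)%card \/ (B #<= A)%card.
Proof.
pose P (G : set (T * U)) := G `<=` A `*` B /\
  forall p q, G p -> G q -> (p.1 = q.1 <-> p.2 = q.2).
have [F FP Ftot|G [[GAB Ginj] maxG]] := @Zorn_bigcup _ P.
  split=> [p [G /FP[GAB _]]|p q [G FG Gp] [H FH Hq]]; first exact: GAB.
  have [GH|HG] := Ftot _ _ FG FH.
  - by apply: (FP _ FH).2 => //; exact: GH.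
  - by apply: (FP _ FG).2 => //; exact: HG.
have [dom|/existsNP[a /not_implyP[Aa na]]] :=
    pselect (forall a, A a -> exists b, G (a, b)).
  left; apply/card_le_relP; exists (fun a b => G (a, b)); split.
    by move=> a /dom[b Gab]; exists b => //; case: (GAB _ Gab).
  by move=> a a' b _ _ Gab Ga'b; apply/(Ginj _ _ Gab Ga'b).
have [ran|/existsNP[b /not_implyP[Bb nb]]] :=
    pselect (forall b, B b -> exists a, G (a, b)).
  right; apply/card_le_relP; exists (fun b a => G (a, b)); split.
    by move=> y /ran[x Gxy]; exists x => //; case: (GAB _ Gxy).
  by move=> y y' x _ _ Gy Gy'; apply/(Ginj _ _ Gy Gy').
case: (maxG (G `|` [set (a, b)])).
  split=> [|/(_ (a, b)) H]; first exact: subsetUl.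
  by apply: na; exists b; apply: H; right.
split=> [p [/GAB//|->//]|[x y] [x' y'] /=].
move=> [Gp|[-> ->]] [Gq|[-> ->]] //.
- exact: Ginj Gp Gq.
- by split=> E; [case: na; exists y|case: nb; exists x]; rewrite -E.
- by split=> E; [case: na; exists y'|case: nb; exists x']; rewrite E.
Qed.

(** A maximal disjoint family of countably infinite subsets of [A] leaves out only a finite set [Q],
    for an infinite remainder would contain a further member. With [Q] attached to one member [C0],
    each block is countable, and two copies of it inject into the corresponding member. *)
Lemma card_le_double (T : Type) (A : set T) : infinite_set A ->
  (A `*` [set: bool] #<= A)%card.
Proof.
move=> infA; pose D := [set C : set T | C `<=` A /\ (C #= [set: nat])%card].
have [E [ED tE maxE]] := ex_maximal_disjoint_subcollection id D.
pose Q := A `\` \bigcup_(C in E) C.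
have finQ : finite_set Q.
  apply: contrapT => /infiniteP/card_subP[C CN CQ].
  have nEC : ~ E C.
    move=> EC; have : infinite_set C by apply/infiniteP; rewrite (card_le_eqr CN).
    apply; suff -> : C = set0 by [].
    by apply/seteqP; split=> // x Cx; case: (CQ _ Cx) => _; apply; exists C.
  case: (maxE (E `|` [set C])).
  - by split=> [|/(_ C) H]; [exact: subsetUl|apply: nEC; apply: H; right].
  - by move=> _ [/ED//|->]; split=> // x /CQ[].
  move=> X Y [EX|->] [EY|->] // [x [Xx Yx]].
  - by apply: tE => //; exists x.
  - by case: (CQ _ Yx) => _; case; exists X.
  - by case: (CQ _ Xx) => _; case; exists Y.
have [C0 EC0] : E !=set0.
  apply/set0P/eqP => E0; apply: infA; rewrite (_ : A = Q)// /Q E0 bigcup_set0.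
  by rewrite setD0.
pose block C := C `|` [set x | C = C0 /\ Q x].
have /choice[e He] (C : set T) : exists f : T -> nat,
    E C -> {in block C &, injective f}.
  have [EC|//] := pselect (E C); last by exists (fun=> 0%N).
  have [_ CN] := ED _ EC.
  have : countable (block C).
    apply: (@sub_countable _ _ _ (\bigcup_(b in [set: bool]) if b then C else Q)).
      by apply: subset_card_le => x [Cx|[_ Qx]]; [exists true|exists false].
    apply: bigcup_countable => // -[] _; last exact: finite_set_countable.
    by rewrite /countable (card_le_eql CN).
  by move=> /pcard_injP[f fI]; exists f.
have [t0 At0] : A !=set0 by apply/set0P/eqP => A0; apply: infA; rewrite A0.
have /choice[d Hd] (C : set T) : exists f : nat -> T,
    E C -> injective f /\ forall n, C (f n).
  have [EC|//] := pselect (E C); last by exists (fun=> t0).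
  have [_ CN] := ED _ EC.
  have /card_le_relP[r [rC rI]] : ([set: nat] #<= C)%card by rewrite (card_le_eqr CN).
  have /choice[f Hf] (n : nat) : exists x, C x /\ r n x.
    by have [//|x] := rC n; exists x.
  exists f => _; split=> [n n' fn|n]; last by case: (Hf n).
  by apply: (rI n n' (f n)) => //; [case: (Hf n)|rewrite fn; case: (Hf n')].
apply/card_le_relP.
(* The image determines [C] by disjointness, then the bit by parity, and then the code of [x] within
   its block. *)
exists (fun (x : T * bool) y =>
  exists C, [/\ E C, block C x.1 & y = d C ((e C x.1).*2 + x.2)%N]).
split=> [[x b] [/= Ax _]|[x b] [x' b'] y _ _ [C [EC Cx ->]] [C' [EC' Cx' /= dd]]].
- have [C EC Cx] : exists2 C, E C & block C x.
    have [[C EC Cx]|nx] := pselect ((\bigcup_(C in E) C) x).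
      by exists C => //; left.
    by exists C0 => //; right.
  exists (d C ((e C x).*2 + b)%N); last by exists C.
  by have [CA _] := ED _ EC; apply: CA; case: (Hd C EC).
- have [dI dC] := Hd C EC.
  have CC' : C = C'.
    apply: tE => //; exists (d C ((e C x).*2 + b)%N); split; first exact: dC.
    by rewrite /= dd; case: (Hd C' EC').
  move: Cx' dd; rewrite -{}CC' => Cx' /dI bb.
  have bE : b = b'.
    move/(congr1 odd): bb; rewrite /= !oddD !odd_double.
    by clear; case: b; case: b'.
  congr pair => //; apply: (He C EC); [exact: mem_set|exact: mem_set|].
  by move: bb; rewrite bE => /addIn/double_inj.
Qed.

(** [K] splits into the part sent to [A] and the part sent to [B]. The part of smaller cardinality
    is absorbed: [K] injects into two copies of the other part, which is infinite and so injects its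
    own double. *)
Lemma card_le_setU_infinite (T U : Type) (K : set T) (A B : set U) :
  infinite_set K -> (K #<= A `|` B)%card -> (K #<= A)%card \/ (K #<= B)%card.
Proof.
move=> infK /card_le_relP[r [rAB rI]].
pose KA := K `&` [set k | exists2 a, A a & r k a].
pose KB := K `&` [set k | exists2 a, B a & r k a].
have KU : K = KA `|` KB.
  apply/seteqP; split=> [k Kk|k [[]|[]]//].
  by have [a [Aa|Ba] ra] := rAB k Kk; [left|right]; split=> //; exists a.
have sub (C : set U) : (K `&` [set k | exists2 a, C a & r k a] #<= C)%card.
  apply/card_le_relP; exists r; split=> [k [_ [a Ca ra]]|k k' a [Kk _] [Kk' _]].
    by exists a.
  exact: rI.
have absorb (P Q : set T) : K = P `|` Q -> (P #<= Q)%card -> (K #<= Q)%card.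
  move=> KPQ PQ; have infQ : infinite_set Q.
    move=> finQ; apply: infK; rewrite KPQ finite_setU; split=> //.
    exact: card_le_finite finQ.
  apply: card_le_trans (card_le_double infQ).
  have /card_le_relP[s [sQ sI]] := PQ.
  apply/card_le_relP.
  exists (fun k z => if z.2 then z.1 = k else P k /\ s k z.1); split.
    rewrite KPQ => k [Pk|Qk]; last by exists (k, true).
    by have [q Qq sq] := sQ _ Pk; exists (q, false).
  move=> k k' [q []] _ _ /=; first by move=> -> .
  by move=> [Pk sk] [Pk' sk']; exact: sI sk sk'.
have [AB|BA] := card_le_total KA KB.
- by right; apply: card_le_trans (absorb _ _ KU AB) (sub _).
- by left; apply: card_le_trans (absorb _ _ _ BA) (sub _); rewrite setUC.
Qed.

(** The bound on the language makes [K] infinite, as a finite [K] would inject into [nat]. *)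
Lemma small_setU (L : language) (K V : Type) (A B : set V) :
  small K [set: fsym L + rsym L + nat] -> small K A -> small K B ->
  small K (A `|` B).
Proof.
move=> smallL smallA smallB KAB.
have infK : infinite_set [set: K].
  move=> finK; apply: smallL.
  have [NK|KN] := card_le_total [set: nat] [set: K].
    by have /infiniteP := NK.
  apply: card_le_trans KN _; apply/card_le_relP.
  exists (fun n z => z = inr n); split=> [n _|n n' z _ _ -> []//].
  by exists (inr n).
by case: (card_le_setU_infinite infK KAB).
Qed.

End Cardinals.

(** * Transfer between parameter sets *)

Section Transfer.
Variables (L : language) (U : structure L).

Definition incl (A B : set U) (AB : A `<=` B) (c : set_type A) : set_type B :=
  SigSub (mem_set (AB _ (set_valP c))).

Definition lift (V : Type) (A B : set U) (AB : A `<=` B)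
    (phi : formula L (V + set_type A)) : formula L (V + set_type B) :=
  fmap (on_constants (incl AB)) phi.

Lemma up_lift (V : Type) (A B : set U) (AB : A `<=` B)
    (phi : formula L (V + set_type A)) : up (lift AB phi) = up phi.
Proof.
by rewrite /up /lift fmap_comp; congr fmap; apply/funext => -[].
Qed.

Definition res (X : Type) (A B : set U) (AB : A `<=` B) : stype X B -> stype X A :=
  pull (h := on_constants (incl AB)) (fun c a => erefl).

Lemma res_realizes (X : Type) (A B : set U) (AB : A `<=` B) (a : X -> U)
    (q : stype X B) :
  realizes a q -> realizes a (res AB q).
Proof. exact: pull_realizes. Qed.

Lemma res_continuous (X : Type) (A B : set U) (AB : A `<=` B) :
  continuous (@res X A B AB).
Proof. exact: pull_continuous. Qed.

Lemma res_compact (X : Type) (A B : set U) (AB : A `<=` B) (C : set (stype X B)) :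
  compact C -> closed (res AB @` C).
Proof.
move=> cC; apply: compact_closed; first exact: stype_hausdorff.
apply: continuous_compact => //; apply: continuous_subspaceT.
exact: res_continuous.
Qed.

Lemma borel_open (T : ptopologicalType) (O : set T) :
  open O -> measurable (O : set (borel T)).
Proof. exact: sub_sigma_algebra. Qed.

Lemma borel_closed (T : ptopologicalType) (C : set T) :
  closed C -> measurable (C : set (borel T)).
Proof.
by move=> cC; rewrite -(setCK C); apply: measurableC; apply: borel_open; exact: closed_openC.
Qed.

Lemma le_measure_sub (R : realType) d (T : measurableType d)
    (P : {measure set T -> \bar R}) (E F : set T) :
  measurable E -> measurable F -> E `<=` F -> (P E <= P F)%E.
Proof. by move=> mE mF; apply: le_measure; exact: mem_set. Qed.

(* Inner regularity on one side, outer regularity on the other, and a formula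
   over the common parameter set in between: no measurability of E itself is
   needed. *)
Lemma regular_transfer_le (R : realType) (X : Type) (B0 B1 B2 : set U)
    (s1 : B0 `<=` B1) (s2 : B0 `<=` B2)
    (P : probability (borel (stype X B1)) R)
    (Q : probability (borel (stype X B2)) R) (E : set (stype X B0)) :
  regular P -> regular Q ->
  (forall phi : formula L (X + set_type B0),
     P (clopen_of (lift s1 phi)) = Q (clopen_of (lift s2 phi))) ->
  measurable (res s1 @^-1` E : set (borel (stype X B1))) ->
  measurable (res s2 @^-1` E : set (borel (stype X B2))) ->
  (P (res s1 @^-1` E) <= Q (res s2 @^-1` E))%E.
Proof.
move=> rP rQ PQ mE1 mE2; rewrite (rP _ mE1).2.
apply: ge_ereal_sup => _ [C [cC CE] <-].
pose D := res s1 @` C.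
have cD : compact D.
  apply: continuous_compact => //; apply: continuous_subspaceT.
  exact: res_continuous.
have clD' : closed (res s2 @^-1` D).
  by apply: preimage_closed; [move=> p _; exact: res_continuous | exact: res_compact].
apply: (@le_trans _ _ (Q (res s2 @^-1` D))); last first.
  apply: le_measure_sub; [exact: (borel_closed clD')|by []|].
  by move=> q [p Cp pq] /=; rewrite -pq; exact: CE.
rewrite (rQ _ (borel_closed clD')).1.
apply: le_ereal_inf_tmp => _ [V [oV DV] <-].
have cV : compact (~` V).
  exact: (subclosed_compact (open_closedC oV) (@stype_compact L U X B2)).
(* These are the types over [B0] all of whose extensions to [B2] lie in [V]. They form an open set
   containing [D], so one formula over [B0] separates. *)
have oD2 : open (~` (res s2 @` (~` V))) by apply: closed_openC; exact: res_compact.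
have [|phi Dphi phiV] := compact_open_clopen cD oD2.
  by move=> _ [p Cp <-] [q nVq qp]; apply/nVq/DV; exists p.
apply: (@le_trans _ _ (P (clopen_of (lift s1 phi)))).
  apply: le_measure_sub.
  - by apply: borel_closed; apply: compact_closed => //; exact: stype_hausdorff.
  - by apply: borel_open; exact: open_clopen_of.
  - by move=> p Cp; apply: (Dphi (res s1 p)); exists p.
rewrite PQ; apply: le_measure_sub.
- by apply: borel_open; exact: open_clopen_of.
- exact: borel_open.
- by move=> q qphi; apply: contrapT => nVq; apply: (phiV (res s2 q)) => //; exists q.
Qed.

Lemma measurable_borel_R (R : realType) (T : ptopologicalType) (f : T -> R) :
  continuous f -> measurable_fun setT (f : borel T -> R).
Proof.
move=> /continuousP cf; apply: (measurability _ (RGenOpens.measurableE R)).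
move=> _ [_ [a [b ->] <-]]; rewrite setTI; apply: borel_open.
exact/cf/interval_open.
Qed.

Lemma measurable_borel (T T' : ptopologicalType) (f : T -> T') :
  continuous f -> measurable_fun setT (f : borel T -> borel T').
Proof.
move=> /continuousP cf; apply: (@measurability _ _ (borel T) (borel T') setT f (@open T')) => //.
by move=> _ [V oV <-]; rewrite setTI; apply: borel_open; exact: cf.
Qed.

(** Both integrals are computed from the laws of [f] and [g] on the real line, which coincide. *)
Lemma Rintegral_transfer (R : realType) d1 d2 (T1 : measurableType d1)
    (T2 : measurableType d2) (P : {measure set T1 -> \bar R})
    (Q : {measure set T2 -> \bar R}) (f : T1 -> R) (g : T2 -> R) :
  measurable_fun setT f -> measurable_fun setT g ->
  (forall x, 0 <= f x) -> (forall x, 0 <= g x) ->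
  (forall E : set R, measurable E -> P (f @^-1` E) = Q (g @^-1` E)) ->
  \int[P]_x f x = \int[Q]_x g x.
Proof.
move=> mf mg f0 g0 PQ; rewrite /Rintegral; congr fine.
(* The identity is replaced by its positive part, as the change of variables is used for nonnegative
   integrands; the two agree on the values of [f] and [g]. *)
pose h (r : R) := (Num.max r 0)%:E.
have mh : measurable_fun setT h by apply/measurable_EFinP; exact: measurable_maxr.
have fE x : (f x)%:E = h (f x) by rewrite /h max_l.
have gE x : (g x)%:E = h (g x) by rewrite /h max_l.
under eq_integral do rewrite fE; under [RHS]eq_integral do rewrite gE.
have h0 : {in setT, forall r, (0 <= h r)%E}.
  by move=> r _; rewrite lee_fin le_max lexx orbT.
transitivity (\int[pushforward P f]_r h r)%E.
  by rewrite (ge0_integral_pushforward mf P).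
transitivity (\int[pushforward Q g]_r h r)%E; last first.
  by rewrite (ge0_integral_pushforward mg Q).
by apply: eq_measure_integral => E mE _; exact: PQ.
Qed.

End Transfer.

(** * Fibre functions and Morley products *)

Section Fibres.
Variables (R : realType) (L : language) (U : structure L).

Definition plug (X Y : Type) (b : Y -> U) (z : (X + Y) + U) : X + U :=
  match z with
  | inl (inl x) => inl x
  | inl (inr y) => inr (b y)
  | inr c => inr c
  end.

Lemma instE (X Y : Type) (A : set U) (phi : formula L ((X + Y) + set_type A))
    (b : Y -> U) : inst phi b = fmap (plug b) (up phi).
Proof. by rewrite /inst /up fmap_comp; congr fmap; apply/funext => -[[]|]. Qed.

Lemma eq_inst (X Y : Type) (A B : set U) (phi : formula L ((X + Y) + set_type A))
    (psi : formula L ((X + Y) + set_type B)) :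
  up phi = up psi -> inst phi = inst psi.
Proof. by move=> E; apply/funext => b; rewrite !instE E. Qed.

Lemma tp_pull (X X' : Type) (A B : set U)
    (h : X' + set_type A -> X + set_type B)
    (hA : forall c (a : X -> U), asg a (h (inr c)) = \val c) (a : X -> U) :
  pull hA (tp B a) = tp A (pull_asg h a).
Proof. by apply: realizes_tp; apply: pull_realizes; exact: tp_realizes. Qed.

(* Finitely many parameters of B can be traded for additional variables. *)
Lemma inst_pure (X Y : finType) (A B : set U) (AB : A `<=` B)
    (phi : formula L ((X + Y) + set_type B)) :
  exists (Z : finType) (psi : formula L (X + Z))
    (h : Z + set_type A -> Y + set_type B),
    (forall c (a : Y -> U), asg a (h (inr c)) = \val c) /\
    forall b, inst phi b = inst (pure A psi) (pull_asg h b).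
Proof.
have [Z [psi [c E]]] := fmap_finite_constants phi id.
pose assoc (z : (X + Y) + Z) : X + (Y + Z) :=
  match z with
  | inl (inl x) => inl x
  | inl (inr y) => inr (inl y)
  | inr z => inr (inr z)
  end.
pose h (z : (Y + Z) + set_type A) : Y + set_type B :=
  match z with
  | inl (inl y) => inl y
  | inl (inr z) => inr (c z)
  | inr d => inr (incl AB d)
  end.
exists (Y + Z)%type, (fmap assoc psi), h; split=> // b.
have -> : inst phi b = inst (fmap (on_constants c) psi) b.
  by rewrite -E /inst fmap_comp.
rewrite /inst /pure !fmap_comp; congr fmap.
by apply/funext => -[[]|].
Qed.

Variables (X : finType) (mu : kmeasure R U X).

(** Unlike in [invariant_over], the formula may carry parameters from [A]; this is what makes the
    fibre function of such a formula single-valued. *)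
Definition respects (A : set U) := forall (Y : finType)
    (phi : formula L ((X + Y) + set_type A)) (b b' : Y -> U),
  equiv_over A b b' -> mu (inst phi b) = mu (inst phi b').

(** Once the parameters of [phi] have become variables, [b] and [b'] are extended by the same
    elements of [B], and the extended tuples have the same type over [A]. *)
Lemma invariant_respects (A B : set U) : A `<=` B -> invariant_over mu A ->
  respects B.
Proof.
move=> AB inv Y phi b b' bb'.
have [Z [psi [h [hA E]]]] := inst_pure AB phi.
by rewrite !E; apply: inv; rewrite /equiv_over -!(tp_pull hA) bb'.
Qed.

Lemma FibE (Y : finType) (A : set U) (phi : formula L ((X + Y) + set_type A)) b q :
  respects A -> realizes b q -> Fib mu phi q = mu (inst phi b).
Proof.
move=> inv bq; apply: xget_unique; first by exists b.
move=> _ [b' b'q ->]; apply: inv.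
by rewrite /equiv_over -(realizes_tp bq) -(realizes_tp b'q).
Qed.

Lemma Fib_ge0 (Y : finType) (A : set U) (phi : formula L ((X + Y) + set_type A)) q :
  0 <= Fib mu phi q.
Proof.
by rewrite /Fib; case: xgetP => // r _ [b _ ->]; exact: km_ge0.
Qed.

Variable K : Type.
Hypothesis satU : saturated K U.

(** Saturation realizes [q], and any realization also realizes the restriction of [q] to [A], whose
    fibre value is independent of the realization. *)
Lemma Fib_res (Y : finType) (A B : set U) (AB : A `<=` B)
    (phi : formula L ((X + Y) + set_type A))
    (psi : formula L ((X + Y) + set_type B)) q :
  small K B -> respects A -> up phi = up psi ->
  Fib mu psi q = Fib mu phi (res AB q).
Proof.
move=> smallB rA E; have [b bq] := satU smallB q.
rewrite (FibE phi rA (res_realizes (AB := AB) bq)) (eq_inst E).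
apply: xget_unique; first by exists b.
move=> _ [b' b'q ->]; rewrite -(eq_inst E); apply: rA.
rewrite /equiv_over -(realizes_tp (res_realizes (AB := AB) bq)).
by rewrite -(realizes_tp (res_realizes (AB := AB) b'q)).
Qed.

(** Trading parameters for variables reduces fibres of formulas over [B] to those of pure formulas
    over [A], so that continuity and Borel measurability pass from [A] to [B]. *)
Lemma Fib_factor (Y : finType) (A B : set U)
    (phi : formula L ((X + Y) + set_type B)) :
  A `<=` B -> small K B -> invariant_over mu A ->
  exists (Z : finType) (psi : formula L (X + Z)) (f : stype Y B -> stype Z A),
    continuous f /\ Fib mu phi = Fib mu (pure A psi) \o f.
Proof.
move=> AB smallB inv.
have [Z [psi [h [hA E]]]] := inst_pure AB phi.
exists Z, psi, (pull hA); split; first exact: pull_continuous.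
apply/funext => q /=; have [b bq] := satU smallB q.
rewrite (FibE _ (invariant_respects AB inv) bq) E.
by rewrite (FibE _ (invariant_respects (@subset_refl _ A) inv) (pull_realizes (hA := hA) bq)).
Qed.

Lemma Fib_continuous (Y : finType) (A B : set U)
    (phi : formula L ((X + Y) + set_type B)) :
  A `<=` B -> small K B -> definable_over K mu A -> continuous (Fib mu phi).
Proof.
move=> AB smallB [_ inv cont].
have [Z [psi [f [cf ->]]]] := Fib_factor phi AB smallB inv.
by move=> q; apply: continuous_comp; [exact: cf|exact: cont].
Qed.

Lemma Fib_measurable (Y : finType) (A B : set U)
    (phi : formula L ((X + Y) + set_type B)) :
  A `<=` B -> small K B -> borel_definable_over K mu A ->
  measurable_fun setT (Fib mu phi : borel (stype Y B) -> R).
Proof.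
move=> AB smallB [_ inv meas].
have [Z [psi [f [cf ->]]]] := Fib_factor phi AB smallB inv.
apply: (@measurableT_comp _ _ _ (borel (stype Y B)) (borel (stype Z A)) R).
  exact: meas.
exact: measurable_borel.
Qed.

Lemma definable_borel (A : set U) : definable_over K mu A ->
  borel_definable_over K mu A.
Proof.
by move=> [smallA inv cont]; split=> // Y phi; apply: measurable_borel_R; exact: cont.
Qed.

(** Both fibre functions factor through types over [B0], so preimages under them are compared by
    [regular_transfer_le]. With [m1] equal to [m2] this changes the parameter set; with [B1] equal
    to [B2] it changes the measure. *)
Lemma Fib_integral_eq (Y : finType) (m1 m2 : kmeasure R U Y) (B0 B1 B2 : set U)
    (s1 : B0 `<=` B1) (s2 : B0 `<=` B2)
    (phi0 : formula L ((X + Y) + set_type B0))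
    (phi1 : formula L ((X + Y) + set_type B1))
    (phi2 : formula L ((X + Y) + set_type B2))
    (P1 : probability (borel (stype Y B1)) R)
    (P2 : probability (borel (stype Y B2)) R) :
  small K B1 -> small K B2 -> respects B0 ->
  up phi0 = up phi1 -> up phi0 = up phi2 ->
  measurable_fun setT (Fib mu phi1 : borel (stype Y B1) -> R) ->
  measurable_fun setT (Fib mu phi2 : borel (stype Y B2) -> R) ->
  represents m1 P1 -> represents m2 P2 -> restr B0 m1 = restr B0 m2 ->
  \int[P1]_q Fib mu phi1 q = \int[P2]_q Fib mu phi2 q.
Proof.
move=> small1 small2 r0 E1 E2 mF1 mF2 [reg1 rep1] [reg2 rep2] m12.
have P12 (psi : formula L (Y + set_type B0)) :
    P1 (clopen_of (lift s1 psi)) = P2 (clopen_of (lift s2 psi)).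
  by rewrite rep1 rep2 !up_lift; congr (_ %:E); exact: (congr1 (@^~ psi) m12).
have F1 : Fib mu phi1 = Fib mu phi0 \o res s1.
  by apply/funext => q; exact: Fib_res.
have F2 : Fib mu phi2 = Fib mu phi0 \o res s2.
  by apply/funext => q; exact: Fib_res.
apply: Rintegral_transfer => //; try by move=> ?; exact: Fib_ge0.
move=> V mV.
have m1V : measurable (res s1 @^-1` (Fib mu phi0 @^-1` V) : set (borel (stype Y B1))).
  by have := mF1 measurableT V mV; rewrite setTI F1.
have m2V : measurable (res s2 @^-1` (Fib mu phi0 @^-1` V) : set (borel (stype Y B2))).
  by have := mF2 measurableT V mV; rewrite setTI F2.
rewrite F1 F2; apply/eqP; rewrite eq_le; apply/andP; split.
  exact: (regular_transfer_le reg1 reg2 P12 m1V m2V).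
exact: (regular_transfer_le reg2 reg1 (fun psi => esym (P12 psi)) m2V m1V).
Qed.

End Fibres.

Section Morley.
Variables (R : realType) (L : language) (T : set (sentence L)) (K : Type).
Variables (U : structure L) (hU : monster T K U) (X Y : finType).

Let satU : saturated K U. Proof. by case: hU. Qed.

Let smallU (A B : set U) : small K A -> small K B -> small K (A `|` B).
Proof. by apply: small_setU; case: hU => _ + _ _; exact. Qed.

(** The integral over any other admissible [B'] is compared with this one by passing both to the
    union of [B] and [B']. *)
Lemma morleyE (mu : kmeasure R U X) (nu : kmeasure R U Y) (A B : set U)
    (phi : formula L ((X + Y) + set_type B))
    (P : probability (borel (stype Y B)) R) :
  borel_definable_over K mu A -> small K B -> A `<=` B -> represents nu P ->
  morley K mu nu (up phi) = \int[P]_q Fib mu phi q.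
Proof.
move=> bmu smallB AB rP; apply: xget_unique; first by exists A, B, phi, P.
move=> _ [A' [B' [phi' [P' [bmu' [smallB' AB'] E rP' ->]]]]].
have rQ := representing_measureP (B `|` B') nu.
have smallBB := smallU smallB smallB'.
have sB : B `<=` B `|` B' by exact: subsetUl.
have sB' : B' `<=` B `|` B' by exact: subsetUr.
have [[_ inv _] [_ inv' _]] := (bmu, bmu').
transitivity (\int[representing_measure (A := B `|` B') nu]_q Fib mu (lift sB phi) q).
  apply: (Fib_integral_eq (phi0 := phi') satU (@subset_refl _ B') sB') rP' rQ erefl => //.
  - exact: invariant_respects inv'.
  - by rewrite up_lift.
  - exact: Fib_measurable bmu'.
  - by apply: Fib_measurable bmu => //; exact: subset_trans sB.
apply: (Fib_integral_eq (phi0 := phi) satU sB (@subset_refl _ B)) rQ rP erefl => //.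
- exact: invariant_respects inv.
- by rewrite up_lift.
- by apply: Fib_measurable bmu => //; exact: subset_trans sB.
- exact: Fib_measurable bmu.
Qed.

End Morley.

(** * Finitely satisfiable measures *)

Section FiniteSatisfiability.
Variables (R : realType) (L : language) (U : structure L).

(* phi(a, y), with a in M, as a formula over M *)
Definition plug_left (X Y : Type) (M : set U) (a : X -> set_type M)
    (z : (X + Y) + set_type M) : Y + set_type M :=
  match z with
  | inl (inl x) => inr (a x)
  | inl (inr y) => inl y
  | inr c => inr c
  end.

Lemma inst_sat (X Y : Type) (A : set U) (phi : formula L ((X + Y) + set_type A))
    (a : X -> U) (b : Y -> U) :
  sat (inst phi b) (gasg a) <->
  sat phi (asg (fun z => match z with inl x => a x | inr y => b y end)).
Proof.
rewrite /inst sat_fmap; set h := (X in gasg a \o X).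
set e := (X in sat phi X).
have -> // : gasg a \o h = e.
by apply/funext => -[[]|].
Qed.

(** If [phi(x, c)] had larger measure than [phi(x, c')], their difference would have positive
    measure and be realized by some [a] in [M]; then [phi(a, y)] would distinguish the types of [c]
    and [c'] over [M]. *)
Lemma fs_respects (X : finType) (nu : kmeasure R U X) (M : set U) :
  finitely_satisfiable M nu -> respects nu M.
Proof.
move=> fs Y phi b b' bb'.
suff le c c' : equiv_over M c c' -> nu (inst phi c) <= nu (inst phi c').
  by apply/eqP; rewrite eq_le !le//; exact: esym.
move=> cc'; rewrite leNgt; apply/negP => lt.
pose d := Neg (Imp (inst phi c) (inst phi c')).
have : 0 < nu d.
  rewrite -subr_gt0 in lt; apply: lt_le_trans lt _; rewrite lerBlDl.
  apply: le_trans (km_Or_le _ _ _); apply: km_sub => a.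
  rewrite sat_Or /d sat_Neg /=.
  by have [?|?] := pselect (sat (inst phi c') (gasg a)); [left|right; tauto].
move=> /fs[a Ma]; rewrite /d sat_Neg /=; apply => /inst_sat sc; apply/inst_sat.
pose aM x : set_type M := SigSub (mem_set (Ma x)).
have H (e : Y -> U) : sval (tp M e) (fmap (plug_left aM) phi) <->
    sat phi (asg (fun z => match z with inl x => a x | inr y => e y end)).
  rewrite /= sat_fmap; set f := (X in sat phi X); set g := (X in _ <-> sat phi X).
  by have -> // : f = g; apply/funext => -[[]|].
by apply/H; rewrite -cc'; apply/H.
Qed.

(* A finitely satisfiable measure only sees types realized in M. *)
Lemma fs_ae_eq (Y : finType) (nu : kmeasure R U Y) (M B : set U)
    (P : probability (borel (stype Y B)) R) (f g : stype Y B -> R) :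
  finitely_satisfiable M nu -> represents nu P ->
  continuous f -> continuous g ->
  (forall a, (forall y, M (a y)) -> f (tp B a) = g (tp B a)) ->
  \int[P]_q f q = \int[P]_q g q.
Proof.
move=> fs [reg rep] cf cg fg; rewrite /Rintegral; congr fine.
pose N := [set q | f q != g q].
have oN : open N.
  suff -> : N = (fun q => f q - g q) @^-1` (~` [set 0]).
    apply: open_comp; last by apply: closed_openC; exact: closed_eq.
    by move=> q _; apply: continuousB; [exact: cf|exact: cg].
  by apply/seteqP; split=> q /=; rewrite /N /= -subr_eq0 => /eqP.
(* By inner regularity it suffices to treat clopen subsets of [N]. One of positive measure would
   contain a type realized in [M], where [f] and [g] agree. *)
have PN : P N = 0%E.
  apply/eqP; rewrite eq_le measure_ge0 andbT (reg _ (borel_open oN)).2.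
  apply: ge_ereal_sup => _ [C [cC CN] <-].
  have [psi Cpsi psiN] := compact_open_clopen cC oN CN.
  apply: (@le_trans _ _ (P (clopen_of psi))).
    apply: le_measure_sub => //.
      by apply: borel_closed; apply: compact_closed => //; exact: stype_hausdorff.
    by apply: borel_open; exact: open_clopen_of.
  rewrite rep lee_fin leNgt; apply/negP => /fs[a Ma /sat_up sa].
  by have /eqP := psiN (tp B a) sa; apply; exact: fg.
apply: ae_eq_integral => //.
- by apply/measurable_EFinP; exact: measurable_borel_R.
- by apply/measurable_EFinP; exact: measurable_borel_R.
- exists N; split=> //; first exact: borel_open.
  move=> q /= H; apply/negP => /eqP fgq; apply: H => _.
  by rewrite fgq.
Qed.

End FiniteSatisfiability.

(** * Commutation of the two Morley products *)

Definition swap_atoms (X Y C : Type) (z : (X + Y) + C) : (Y + X) + C :=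
  match z with
  | inl (inl x) => inl (inr x)
  | inl (inr y) => inl (inl y)
  | inr c => inr c
  end.

Theorem theorem5p7 (R : realType) (L : language) (T : set (sentence L))
  (hT : complete_theory T) (K : Type) (U : structure L) (hU : monster T K U)
  (M : set U) (smallM : small K M) (hM : elementary_sub M)
  (X Y : finType) (mu : kmeasure R U X) (nu : kmeasure R U Y)
  (hmu : definable_over K mu M)
  (hnu : borel_definable K nu) (hnuM : finitely_satisfiable M nu)
  (hext : exists muh : kmeasure R U X,
     [/\ definable K muh,
         restr M muh = restr M mu &
         restr M (morley K muh nu) =
         restr M (morley_swap K nu muh)]) :
  restr M (morley K mu nu) = restr M (morley_swap K nu mu).
Proof.
have [muh [[A' dmuh] ext comm]] := hext; have [A bnu] := hnu.
have smallU B C : small K B -> small K C -> small K (B `|` C).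
  by apply: small_setU; case: hU => _ + _ _; exact.
have satU : saturated K U by case: hU.
have [smallA invnu _] := bnu; have [smallA' invmuh _] := dmuh.
have [_ invmu _] := hmu.
apply/funext => phi.
transitivity (restr M (morley K muh nu) phi).
  have sM : M `<=` M `|` A' by exact: subsetUl.
  have sA' : A' `<=` M `|` A' by exact: subsetUr.
  have sB : small K (M `|` A') by exact: smallU.
  rewrite /restr -(up_lift sM).
  rewrite (morleyE hU _ (definable_borel hmu) sB sM (representing_measureP _ nu)).
  rewrite (morleyE hU _ (definable_borel dmuh) sB sA' (representing_measureP _ nu)).
  (* Over the union of [M] and [A'] both fibre functions are continuous, so only types of tuples
     from [M] have to be compared. *)
  apply: (fs_ae_eq hnuM (representing_measureP _ nu)).
  - exact: (@Fib_continuous _ _ _ _ mu _ satU _ _ _ _ sM sB hmu).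
  - exact: (@Fib_continuous _ _ _ _ muh _ satU _ _ _ _ sA' sB dmuh).
  move=> a Ma.
  rewrite (FibE _ (invariant_respects sM invmu) (@tp_realizes _ _ _ _ a)).
  rewrite (FibE _ (invariant_respects sA' invmuh) (@tp_realizes _ _ _ _ a)).
  pose aM y : set_type M := SigSub (mem_set (Ma y)).
  pose plug_right (z : (X + Y) + set_type M) : X + set_type M :=
    match z with
    | inl (inl x) => inl x
    | inl (inr y) => inr (aM y)
    | inr c => inr c
    end.
  (* As [a] lies in [M], this instance is an [M]-formula, on which [mu] and [muh] agree. *)
  have -> : inst (lift sM phi) a = up (fmap plug_right phi).
    by rewrite /inst /up /lift !fmap_comp; congr fmap; apply/funext => -[[]|].
  exact: (congr1 (@^~ _) (esym ext)).
(* The commutation of [muh] with [nu] leaves the product with [nu] on the left, where [muh] is to be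
   replaced by [mu]. *)
rewrite comm /restr /morley_swap.
have -> : swap_vars (up phi) = up (fmap (@swap_atoms X Y _) phi).
  by rewrite /swap_vars /up !fmap_comp; congr fmap; apply/funext => -[[]|].
have sM : M `<=` M `|` A by exact: subsetUl.
have sA : A `<=` M `|` A by exact: subsetUr.
have sB : small K (M `|` A) by exact: smallU.
rewrite -(up_lift sM).
rewrite (morleyE hU _ bnu sB sA (representing_measureP _ muh)).
rewrite (morleyE hU _ bnu sB sA (representing_measureP _ mu)).
(* Here [B0] is [M]: the fibre function of [nu] factors through types over [M] by finite
   satisfiability, while its measurability over the union comes from [A]. *)
apply: (Fib_integral_eq (phi0 := fmap (@swap_atoms X Y _) phi) satU sM sM) ext => //.
- exact: fs_respects.
- by rewrite up_lift.
- by rewrite up_lift.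
- exact: (Fib_measurable satU _ sA).
- exact: (Fib_measurable satU _ sA).
- exact: representing_measureP.
- exact: representing_measureP.
Qed.
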